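(* For every real Banach space $X$ with $\dim X\ge 2$ and every $\lambda\in[0,1]$, $$0\le J_\lambda^\perp(X)\le 1.$$ Moreover, if $0<\lambda<1$, then $$J_\lambda^\perp(X)\ge\max\{\lambda,|2\lambda-1|\}.$$
   Context: For a real Banach space $X$, $S_X=\{x\in X:\|x\|=1\}$. For $x,y\in X$, $x\perp_B y$ (Birkhoff--James orthogonality) means $\|x\|\le\|x+ty\|$ for every $t\in\mathbb R$. For $\lambda\in[0,1]$, $$J_\lambda^\perp(X)=\sup\{\min\{\|\lambda x+(1-\lambda)y\|,\|\lambda x-(1-\lambda)y\|\}: x,y\in S_X,\ x\perp_B y\}.$$ *)

(* Defs.v *)
From HB Require Import structures.
From mathcomp Require Import all_boot all_order all_algebra.
From mathcomp Require Import all_classical all_reals all_analysis.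
Import Order.TTheory GRing.Theory Num.Theory.
Import numFieldNormedType.Exports.

Set Implicit Arguments.
Unset Strict Implicit.
Unset Printing Implicit Defensive.

Local Open Scope classical_set_scope.
Local Open Scope ring_scope.

Definition dim_ge2 (R : realType) (X : normedModType R) : Prop :=
  exists x y : X, forall a b : R, a *: x + b *: y = 0 -> a = 0 /\ b = 0.

Definition unit_sphere (R : realType) (X : normedModType R) : set X :=
  [set x | `|x| = 1].

(* Birkhoff-James orthogonality *)
Definition BJ_orth (R : realType) (X : normedModType R) (x y : X) : Prop :=
  forall t : R, `|x| <= `|x + t *: y|.

(* The supremum is taken in the extended reals, where an empty or unbounded
   family gives -oo or +oo, because [sup] on R returns 0 on such families. *)
Definition J_orth (R : realType) (X : normedModType R) (lambda : R) : \bar R :=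
  ereal_sup [set z : \bar R | exists x y : X,
    [/\ unit_sphere x, unit_sphere y, BJ_orth x y &
        z = (Num.min `|lambda *: x + (1 - lambda) *: y|
                     `|lambda *: x - (1 - lambda) *: y|)%:E]].
Arguments J_orth {R} X lambda.

(* Main.v *)
Require Import Defs.
From HB Require Import structures.
From mathcomp Require Import all_boot all_order all_algebra.
From mathcomp Require Import all_classical all_reals all_analysis.
From mathcomp Require Import lra.
Import Order.TTheory GRing.Theory Num.Theory.
Import numFieldNormedType.Exports.

(** Every single orthogonal pair of unit vectors [x], [y] already satisfies both
    bounds: writing [mu = 1 - lambda], the triangle inequality puts
    [`|lambda *: x +- mu *: y|] between [`|lambda - mu|] and [lambda + mu = 1],
    and Birkhoff-James orthogonality, which is homogeneous and insensitive to
    the sign of the second vector, bounds it below by [`|lambda *: x| = lambda].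
    These estimates pass to the supremum as soon as the family is non-empty,
    and this is where the dimension enters: for independent [u] and [v], a
    point of the line [v + R u] closest to the origin exists, is nonzero, and is
    orthogonal to [u] (lemma [BJ_orth_closest_point]); normalising it and [u]
    gives an orthogonal pair in the unit sphere
    (lemma [exists_orth_unit_pair]). *)

Local Open Scope classical_set_scope.
Local Open Scope ring_scope.

Lemma BJ_orthZ (R : realType) (X : normedModType R) (x y : X) (a b : R) :
  BJ_orth x y -> BJ_orth (a *: x) (b *: y).
Proof.
move=> xy t; have [->|a0] := eqVneq a 0.
  by rewrite scale0r normr0.
have -> : a *: x + t *: (b *: y) = a *: (x + (a^-1 * (t * b)) *: y).
  by rewrite scalerDr !scalerA mulrA divff // mul1r.
by rewrite !normrZ ler_wpM2l.
Qed.

(** On the line [v + R u] the norm tends to infinity in both directions, so its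
    minimum over a large enough segment is a global one; minimality at
    [v + t *: u] is precisely orthogonality to [u]. *)
Lemma BJ_orth_closest_point (R : realType) (X : normedModType R) (u v : X) :
  u != 0 -> exists t : R, BJ_orth (v + t *: u) u.
Proof.
move=> u0; have nu : 0 < `|u| by rewrite normr_gt0.
pose f (t : R) := `|v + t *: u|.
(* The radius is chosen so that beyond it f t >= `|t| * `|u| - `|v| >= f 0. *)
pose M : R := 2 * `|v| / `|u|.
have M0 : 0 <= M by rewrite divr_ge0 // mulr_ge0.
have cf : {within `[- M, M], continuous f}.
  apply: continuous_subspaceT => t; apply: cvg_norm.
  by apply: cvgD; [exact: cvg_cst | apply: cvgZr_tmp; exact: cvg_id].
have MM : - M <= M by lra.
have [c _ cmin] := EVT_min MM cf.
exists c => t; rewrite -addrA -scalerDl -/(f c) -/(f (c + t)).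
move: (c + t) => s.
have [sM|Ms] := leP `|s| M.
  by apply: cmin; rewrite in_itv /= -ler_norml.
have c0 : f c <= f 0 by apply: cmin; rewrite in_itv /= -ler_norml normr0.
apply: (le_trans c0); rewrite /f scale0r addr0.
have h1 : 2 * `|v| <= `|s| * `|u| by rewrite -ler_pdivrMr // ltW.
have h2 : `|s *: u| <= `|v + s *: u| + `|v|.
  by have := ler_normB (v + s *: u) v; rewrite addrAC subrr add0r.
by rewrite normrZ in h2; lra.
Qed.

Lemma exists_orth_unit_pair (R : realType) (X : normedModType R) :
  dim_ge2 X ->
  exists x y : X, [/\ unit_sphere x, unit_sphere y & BJ_orth x y].
Proof.
case=> u [v indep].
have u0 : u != 0.
  apply/eqP => u0; have [] := indep 1 0.
    by rewrite u0 scaler0 scale0r addr0.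
  by move/eqP; rewrite oner_eq0.
have [t orth] := BJ_orth_closest_point _ _ u v u0.
have w0 : v + t *: u != 0.
  apply/eqP => w0; have [] := indep t 1.
    by rewrite scale1r addrC.
  by move=> _ /eqP; rewrite oner_eq0.
have unit (z : X) : z != 0 -> unit_sphere (`|z|^-1 *: z).
  by move=> z0; rewrite /unit_sphere /= normrZ normfV normr_id mulVf ?normr_eq0.
exists (`|v + t *: u|^-1 *: (v + t *: u)), (`|u|^-1 *: u).
by split; [exact: unit | exact: unit | exact: BJ_orthZ].
Qed.

(** The scalar [b] is signed, so that one statement serves both terms of the
    minimum. *)
Lemma orth_combination_ge (R : realType) (X : normedModType R) (x y : X)
    (a b : R) :
  unit_sphere x -> unit_sphere y -> BJ_orth x y ->
  Num.max `|a| `| `|a| - `|b| | <= `|a *: x + b *: y|.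
Proof.
rewrite /unit_sphere /= => x1 y1 xy; rewrite ge_max; apply/andP; split.
  have := BJ_orthZ _ _ _ _ a b xy 1.
  by rewrite scale1r normrZ x1 mulr1.
have := ler_dist_dist (a *: x) (- (b *: y)).
by rewrite opprK normrN !normrZ x1 y1 !mulr1.
Qed.

Theorem proposition2p4 (R : realType) (X : completeNormedModType R)
  (hdim : dim_ge2 X) (lambda : R) (hlambda : 0 <= lambda <= 1) :
  (0%:E <= J_orth X lambda <= 1%:E)%E /\
  (0 < lambda < 1 ->
   ((Num.max lambda `|2 * lambda - 1|)%:E <= J_orth X lambda)%E).
Proof.
have /andP[l0 l1] := hlambda.
have m0 : 0 <= 1 - lambda by rewrite subr_ge0.
have lower : ((Num.max lambda `|2 * lambda - 1|)%:E <= J_orth X lambda)%E.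
  have [x [y [x1 y1 xy]]] := exists_orth_unit_pair _ _ hdim.
  apply: (le_trans _ (ereal_sup_ubound _)); last by exists x, y.
  have gap : 2 * lambda - 1 = lambda - (1 - lambda) by lra.
  have hp := orth_combination_ge _ _ _ _ lambda (1 - lambda) x1 y1 xy.
  have hm := orth_combination_ge _ _ _ _ lambda (- (1 - lambda)) x1 y1 xy.
  rewrite normrN scaleNr in hm.
  rewrite (ger0_norm l0) (ger0_norm m0) -gap in hp hm.
  by rewrite lee_fin le_min hp hm.
split=> //; apply/andP; split.
  by apply: le_trans lower; rewrite lee_fin le_max l0.
apply: ge_ereal_sup => _ [x [y [x1 y1 _ ->]]].
rewrite lee_fin ge_min; apply/orP; left.
apply: (le_trans (ler_normD _ _)).
by rewrite !normrZ x1 y1 !mulr1 !ger0_norm // addrC subrK.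
Qed.
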